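(* Let $(M,g)$ be a Riemannian manifold, let $G$ be a Kaluza-Klein metric on $TM$ with functions $A\equiv1$, $B$, $C$, and let $\sigma:(M,g)\to(TM,G)$ be a vector field of constant norm $k$. If $\sigma$ is harmonic (either as a harmonic section or as a harmonic map), then either $\sigma$ is parallel or $$B(k^2)+k^2B'(k^2)=0.$$
   Context: Let $(M,g)$ be a Riemannian manifold with Levi-Civita connection $\nabla$. At $(p,e)\in TM$ the space $T_{(p,e)}TM$ splits into the vertical space (kernel of $d\pi$, $\pi:TM\to M$ the projection) and the horizontal space defined by $\nabla$; each $X\in T_pM$ has a horizontal lift $X^h$ and a vertical lift $X^v$. A Kaluza-Klein metric on $TM$ is a Riemannian metric $G$ such that at $(p,e)$ $$G(X^h,Y^h)=A(|e|^2)g(X,Y),\quad G(X^h,Y^v)=0,\quad G(X^v,Y^v)=B(|e|^2)g(X,Y)+C(|e|^2)g(X,e)g(Y,e),$$ where $A,B,C$ are real $C^2$ functions on $[0,\infty)$, $A>0$, and $B,C$ are such that $G$ is positive definite. A vector field $\sigma$ on $M$ is viewed as a map $\sigma:(M,g)\to(TM,G)$. Its tension field $\tau(\sigma)=\operatorname{trace}\nabla d\sigma$ (computed with the Levi-Civita connections of $g$ and $G$) is decomposed as $\tau(\sigma)=[\tau^h(\sigma)]^h+[\tau^v(\sigma)]^v$ with $\tau^h(\sigma),\tau^v(\sigma)$ vector fields on $M$. $\sigma$ is a harmonic map if $\tau(\sigma)=0$, and a harmonic section if $\tau^v(\sigma)=0$ (equivalently, it is critical for the energy with respect to variations through vector fields).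 *)

(* Defs.v *)
From HB Require Import structures.
From mathcomp Require Import all_boot all_order all_algebra.
From mathcomp Require Import all_classical all_reals all_analysis.
From mathcomp Require Import ring.

Set Implicit Arguments.
Unset Strict Implicit.
Unset Printing Implicit Defensive.

Import Order.TTheory GRing.Theory Num.Theory.
Import numFieldNormedType.Exports.

Local Open Scope classical_set_scope.
Local Open Scope ring_scope.

(* [Ck k U f] is meant for open [U]. *)
Fixpoint Ck (R : realType) (V W : normedModType R) (k : nat) (U : set V)
    (f : V -> W) : Prop :=
  match k with
  | 0 => forall x, U x -> {for x, continuous f}
  | k'.+1 => (forall x, U x -> differentiable f x) /\
             forall v : V, Ck k' U (fun x => 'D_v f x)
  end.

Definition smooth (R : realType) (V W : normedModType R) (U : set V)
  (f : V -> W) : Prop := forall k, Ck k U f.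

(* A function on [0, +oo[ is represented by a function on R whose values at
   negative numbers are irrelevant: only difference quotients inside [0, +oo[
   are used, so that the derivative is the right derivative at 0. *)
Section HalfLine.
Variable R : realType.

Definition halfline_quotient (f : R -> R) (t : R) :=
  (f s - f t) / (s - t) @[s --> within [set s | 0 <= s] t^'].

Definition halfline_derive (f : R -> R) (t : R) : R :=
  lim (halfline_quotient f t).

Fixpoint halfline_Ck (k : nat) (f : R -> R) : Prop :=
  match k with
  | 0 => {within [set s | 0 <= s], continuous f}
  | k'.+1 => (forall t, 0 <= t -> cvg (halfline_quotient f t)) /\
             halfline_Ck k' (halfline_derive f)
  end.

End HalfLine.

(* The underlying data of a manifold, without axioms.  [psi c] inverts the
   chart [phi c : dom c -> 'rV_dim]; its values outside [phi c @` dom c] are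
   irrelevant.  Each point has a preferred chart, and a tangent vector at [p] is
   represented by its components in the preferred chart at [p]. *)
Record atlas (R : realType) := Atlas {
  point :> Type;
  dim : nat;
  index : Type;
  dom : index -> set point;
  phi : index -> point -> 'rV[R]_dim;
  psi : index -> 'rV[R]_dim -> point;
  chart_at : point -> index }.

Arguments dom {R a} _ _.
Arguments phi {R a} _ _.
Arguments psi {R a} _ _.
Arguments chart_at {R a} _.

Section Manifold.
Variables (R : realType) (M : atlas R).
Local Notation tangent M := 'rV[R]_(dim M).

(* The topology of the manifold is the one induced by the charts. *)
Definition atlas_open (U : set M) : Prop :=
  forall c : index M, open (phi c @` (dom c `&` U)).

Record smooth_manifold : Prop := SmoothManifold {
  dom_chart_at : forall p : M, dom (chart_at p) p;
  phiK : forall (c : index M) (p : M), dom c p -> psi c (phi c p) = p;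
  open_overlap : forall c d : index M, open (phi c @` (dom c `&` dom d));
  smooth_transition : forall c d : index M,
    smooth (phi c @` (dom c `&` dom d)) (phi d \o psi c);
  atlas_hausdorff : forall p q : M, p <> q -> exists U V : set M,
    [/\ atlas_open U, atlas_open V, U p, V q & U `&` V = set0];
  atlas_second_countable : exists2 D : set (set M), countable D &
    (forall V, D V -> atlas_open V) /\
    forall (U : set M) (p : M), atlas_open U -> U p ->
      exists V, [/\ D V, V p & V `<=` U] }.

(* Components in the chart [c] of a tangent vector at [p], and conversely. *)
Definition coords (c : index M) (p : M) (v : tangent M) : tangent M :=
  'd (phi c \o psi (chart_at p)) (phi (chart_at p) p) v.

Definition of_coords (c : index M) (p : M) (y : tangent M) : tangent M :=
  'd (phi (chart_at p) \o psi c) (phi c p) y.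

Definition metric := forall p : M, tangent M -> tangent M -> R.

Definition metric_mx (g : metric) (c : index M) (x : 'rV[R]_(dim M)) :
    'M[R]_(dim M) :=
  \matrix_(i, j) g (psi c x) (of_coords c (psi c x) (delta_mx 0 i))
                             (of_coords c (psi c x) (delta_mx 0 j)).

Record Ck_riemannian (k : nat) (g : metric) : Prop := CkRiemannian {
  metric_linear : forall (p : M) (a : R) (u v w : tangent M),
    g p (a *: u + v) w = a * g p u w + g p v w;
  metric_sym : forall (p : M) (u v : tangent M), g p u v = g p v u;
  metric_pos : forall (p : M) (v : tangent M), v != 0 -> 0 < g p v v;
  metric_Ck : forall (c : index M) (i j : 'I_(dim M)),
    Ck k (phi c @` dom c) (fun x => metric_mx g c x i j) }.

Definition riemannian (g : metric) : Prop := forall k, Ck_riemannian k g.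

End Manifold.

(* The Levi-Civita connection of a metric given by its matrix in coordinates.
   The two lemmas below are its defining properties: [christoffel] is torsion-free
   and compatible with the metric. *)
Section LeviCivita.
Variables (R : realType) (n : nat) (h : 'rV[R]_n -> 'M[R]_n).

Definition partial (k i j : 'I_n) (x : 'rV[R]_n) : R :=
  'D_(delta_mx 0 k) (fun y => h y i j) x.

Definition christoffel_symbol (x : 'rV[R]_n) (k i j : 'I_n) : R :=
  2^-1 * \sum_l invmx (h x) k l *
    (partial i j l x + partial j i l x - partial l i j x).

Definition christoffel (x u v : 'rV[R]_n) : 'rV[R]_n :=
  \row_k \sum_i \sum_j christoffel_symbol x k i j * u 0 i * v 0 j.

Hypothesis h_sym : forall x, (h x)^T = h x.

Let hC x i j : h x i j = h x j i.
Proof. by rewrite -[in RHS]h_sym mxE. Qed.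

Let partialC k i j x : partial k i j x = partial k j i x.
Proof.
rewrite /partial; congr derive.
by apply/funext => y; exact: hC.
Qed.

Lemma christoffel_torsion_free x k i j :
  christoffel_symbol x k i j = christoffel_symbol x k j i.
Proof.
congr (_ * _); apply: eq_bigr => l _; congr (_ * _).
by rewrite [partial l i j x]partialC [partial i j l x + _]addrC.
Qed.

Let lower x (k i j : 'I_n) : h x \in unitmx ->
  \sum_l christoffel_symbol x l k i * h x l j =
  2^-1 * (partial k i j x + partial i k j x - partial j k i x).
Proof.
move=> hU.
pose T m := partial k i m x + partial i k m x - partial m k i x.
transitivity (2^-1 * \sum_m (\sum_l h x j l * invmx (h x) l m) * T m).
  rewrite [in RHS](eq_bigr (fun m => \sum_l h x j l * invmx (h x) l m * T m));
    last by move=> m _; rewrite mulr_suml.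
  rewrite exchange_big mulr_sumr; apply: eq_bigr => l _ /=.
  rewrite /christoffel_symbol -mulrA mulr_suml; congr (_ * _).
  by apply: eq_bigr => m _; rewrite mulrAC [_ * h x l j]mulrC [h x l j]hC.
congr (_ * _).
have H m : \sum_l h x j l * invmx (h x) l m = (j == m)%:R :> R.
  by have := congr1 (fun A : 'M[R]_n => A j m) (mulmxV hU); rewrite !mxE.
rewrite (eq_bigr (fun m => (j == m)%:R * T m)); last by move=> m _; rewrite H.
rewrite (bigD1 j) //= eqxx mul1r big1 ?addr0// => m mj.
by rewrite eq_sym (negbTE mj) mul0r.
Qed.

Lemma christoffel_metric x (k i j : 'I_n) : h x \in unitmx ->
  partial k i j x = \sum_l christoffel_symbol x l k i * h x l j
                  + \sum_l christoffel_symbol x l k j * h x i l.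
Proof.
move=> hU; under [X in _ + X]eq_bigr => l _ do rewrite [h x i l]hC.
rewrite !lower // -mulrDr [partial k j i x]partialC.
by field.
Qed.

End LeviCivita.

Section HarmonicMaps.
Variables (R : realType) (M N : atlas R) (g : metric M) (h : metric N).
Local Notation tangent M := 'rV[R]_(dim M).

(* [nabla d f] in coordinates, for maps [F] between coordinate domains. *)
Definition second_fundamental_form (c : index M) (d : index N)
    (F : 'rV[R]_(dim M) -> 'rV[R]_(dim N)) (x u v : 'rV[R]_(dim M)) :
    'rV[R]_(dim N) :=
  'D_u (fun y => 'D_v F y) x
  - 'D_(christoffel (metric_mx g c) x u v) F x
  + christoffel (metric_mx h d) (F x) ('D_u F x) ('D_v F x).

(* The tension field at [p] is a tangent vector of [N] at [f p]. *)
Definition tension (f : M -> N) (p : M) : tangent N :=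
  let c := chart_at p in
  let d := chart_at (f p) in
  let x := phi c p in
  \sum_i \sum_j invmx (metric_mx g c x) i j *:
    second_fundamental_form c d (phi d \o f \o psi c) x
      (delta_mx 0 i) (delta_mx 0 j).

Definition harmonic_map (f : M -> N) : Prop := forall p, tension f p = 0.

End HarmonicMaps.

Section TangentBundle.
Variables (R : realType) (M : atlas R).
Local Notation tangent M := 'rV[R]_(dim M).

Definition tangent_bundle : atlas R := {|
  point := (M * tangent M)%type;
  dim := dim M + dim M;
  index := index M;
  dom := fun c => [set q | dom c q.1];
  phi := fun c q => row_mx (phi c q.1) (coords c q.1 q.2);
  psi := fun c z =>
    (psi c (lsubmx z), of_coords c (psi c (lsubmx z)) (rsubmx z));
  chart_at := fun q => chart_at q.1 |}.

Definition vector_field := M -> tangent M.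

Definition smooth_vector_field (s : vector_field) : Prop :=
  forall c : index M,
    smooth (phi c @` dom c) (fun x => coords c (psi c x) (s (psi c x))).

Definition section (s : vector_field) : M -> tangent_bundle :=
  fun p => (p, s p).

Variable g : metric M.

(* Lifts of [X] to the point [q] of the tangent bundle.  They are computed in a
   chart [c] whose domain contains [q.1] and do not depend on its choice. *)
Definition hlift (c : index M) (q : tangent_bundle) (X : tangent M) :
    tangent tangent_bundle :=
  let X' := coords c q.1 X in
  of_coords (M := tangent_bundle) c q
    (row_mx X' (- christoffel (metric_mx g c) (phi c q.1) X'
                    (coords c q.1 q.2))).

Definition vlift (c : index M) (q : tangent_bundle) (X : tangent M) :
    tangent tangent_bundle :=
  of_coords (M := tangent_bundle) c q (row_mx 0 (coords c q.1 X)).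

(* [nabla_X s] at [p]. *)
Definition covariant_derivative (s : vector_field) (p : M) (X : tangent M) :
    tangent M :=
  let c := chart_at p in
  let S x := coords c (psi c x) (s (psi c x)) in
  'D_X S (phi c p) + christoffel (metric_mx g c) (phi c p) X (S (phi c p)).

Definition parallel (s : vector_field) : Prop :=
  forall p X, covariant_derivative s p X = 0.

(* [G] is only required to be of class C^2 because [A], [B], [C] are. *)
Record kaluza_klein (A B C : R -> R) (G : metric tangent_bundle) : Prop :=
  KaluzaKlein {
    kkA_C2 : halfline_Ck 2 A;
    kkB_C2 : halfline_Ck 2 B;
    kkC_C2 : halfline_Ck 2 C;
    kkA_gt0 : forall t, 0 <= t -> 0 < A t;
    kk_riemannian : Ck_riemannian 2 G;
    kk_hh : forall (c : index M) (p : M) (e X Y : tangent M), dom c p ->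
      G (p, e) (hlift c (p, e) X) (hlift c (p, e) Y) = A (g p e e) * g p X Y;
    kk_hv : forall (c : index M) (p : M) (e X Y : tangent M), dom c p ->
      G (p, e) (hlift c (p, e) X) (vlift c (p, e) Y) = 0;
    kk_vv : forall (c : index M) (p : M) (e X Y : tangent M), dom c p ->
      G (p, e) (vlift c (p, e) X) (vlift c (p, e) Y) =
      B (g p e e) * g p X Y + C (g p e e) * g p X e * g p Y e }.

Definition tension_decomposition (G : metric tangent_bundle)
    (s tau_h tau_v : vector_field) : Prop :=
  forall p : M, tension g G (section s) p =
    hlift (chart_at p) (section s p) (tau_h p) +
    vlift (chart_at p) (section s p) (tau_v p).

Definition harmonic_section (G : metric tangent_bundle) (s : vector_field) :
    Prop :=
  exists tau_h tau_v : vector_field,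
    tension_decomposition G s tau_h tau_v /\ forall p, tau_v p = 0.

End TangentBundle.

(* Main.v *)
(* Pair the tension field with the vertical lift [V] of [sigma], i.e. with the
   Euler field along [sigma].  As the norm of [sigma] is constant, [nabla sigma]
   is orthogonal to [sigma], so [V] is orthogonal to the image of [d sigma].
   Differentiating this orthogonality and using the Koszul formula leaves
     G (tau, V) = - 1/2 tr_g (L_V G) (d sigma, d sigma),
   and the flow of the Euler field is the dilation of the fibres, so the right
   hand side equals - (B (k^2) + k^2 B' (k^2)) |nabla sigma|^2.  The left hand
   side vanishes for harmonic maps and for harmonic sections. *)

From mathcomp Require Import all_boot all_order all_algebra.
From mathcomp Require Import all_classical all_reals all_analysis.
From mathcomp Require Import ring lra.
Require Import Defs.
Import Order.TTheory GRing.Theory Num.Theory.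
Import numFieldNormedType.Exports.
Local Open Scope ring_scope.
Set Implicit Arguments.
Unset Strict Implicit.
Unset Printing Implicit Defensive.

(** * Bilinear forms and derivatives of matrix-valued functions *)

Section BilinearForm.
Variables (R : comNzRingType) (n : nat).
Implicit Types (A : 'M[R]_n) (u v w : 'rV[R]_n).

Definition mxform A u v : R := (u *m A *m v^T) 0 0.

Lemma mxformDl A u v w : mxform A (u + v) w = mxform A u w + mxform A v w.
Proof. by rewrite /mxform !mulmxDl mxE. Qed.

Lemma mxformDr A u v w : mxform A u (v + w) = mxform A u v + mxform A u w.
Proof. by rewrite /mxform linearD mulmxDr mxE. Qed.

Lemma mxformZl A a u v : mxform A (a *: u) v = a * mxform A u v.
Proof. by rewrite /mxform -!scalemxAl mxE. Qed.

Lemma mxformZr A a u v : mxform A u (a *: v) = a * mxform A u v.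
Proof. by rewrite /mxform linearZ -scalemxAr mxE. Qed.

Lemma mxformNl A u v : mxform A (- u) v = - mxform A u v.
Proof. by rewrite -scaleN1r mxformZl mulN1r. Qed.

Lemma mxformNr A u v : mxform A u (- v) = - mxform A u v.
Proof. by rewrite -scaleN1r mxformZr mulN1r. Qed.

Lemma mxform0l A v : mxform A 0 v = 0.
Proof. by rewrite -(scale0r 0) mxformZl mul0r. Qed.

Lemma mxform0r A u : mxform A u 0 = 0.
Proof. by rewrite -(scale0r 0) mxformZr mul0r. Qed.

Lemma mxform_suml A I (r : seq I) (P : pred I) (f : I -> 'rV[R]_n) v :
  mxform A (\sum_(i <- r | P i) f i) v = \sum_(i <- r | P i) mxform A (f i) v.
Proof. by rewrite /mxform !mulmx_suml summxE. Qed.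

Lemma mxformE A u v : mxform A u v = \sum_i \sum_j u 0 i * A i j * v 0 j.
Proof.
rewrite /mxform mxE exchange_big; apply: eq_bigr => j _.
by rewrite mxE mulr_suml; apply: eq_bigr => i _; rewrite mxE.
Qed.

Lemma mxformC A u v : A^T = A -> mxform A u v = mxform A v u.
Proof.
move=> sA; rewrite /mxform -[in RHS](trmxK (v *m A *m u^T)) [RHS]mxE.
by rewrite !trmx_mul !trmxK sA mulmxA.
Qed.

End BilinearForm.

Section DeriveMatrix.
Variables (R : realType) (V : normedModType R).

Lemma is_derive_mxP m n (A : V -> 'M[R]_(m, n)) (x v : V) (dA : 'M[R]_(m, n)) :
  is_derive x v A dA <->
  forall i j, is_derive x v (fun y => A y i j) (dA i j).
Proof.
split=> [[Ax <-] i j|H].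
  rewrite derive_mx// mxE; apply: derivableP.
  by move/derivable_mxP: Ax => /(_ i j).
have Ax : derivable A x v by apply/derivable_mxP => i j; case: (H i j).
apply: DeriveDef => //; rewrite derive_mx//.
by apply/matrixP => i j; rewrite mxE; case: (H i j).
Qed.

Lemma is_derive_mulmx m n p (A : V -> 'M[R]_(m, n)) (B : V -> 'M[R]_(n, p))
    (x v : V) dA dB :
  is_derive x v A dA -> is_derive x v B dB ->
  is_derive x v (fun y => A y *m B y) (dA *m B x + A x *m dB).
Proof.
move=> /is_derive_mxP hA /is_derive_mxP hB; apply/is_derive_mxP => i j.
have -> : (fun y => (A y *m B y) i j) =
    \sum_k ((fun y => A y i k) * (fun y => B y k j)).
  by apply/funext => y; rewrite mxE fct_sumE.
apply: (is_derive_eq (f' := \sum_k (A x i k *: dB k j + B x k j *: dA i k))).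
  by apply: is_derive_sum => k; apply: is_deriveM.
rewrite !mxE -big_split; apply: eq_bigr => k _ /=.
by rewrite addrC [dA i k * _]mulrC.
Qed.

Lemma is_derive_trmx m n (A : V -> 'M[R]_(m, n)) (x v : V) dA :
  is_derive x v A dA -> is_derive x v (fun y => (A y)^T) dA^T.
Proof.
move=> /is_derive_mxP hA; apply/is_derive_mxP => i j; rewrite mxE.
by under eq_fun do rewrite mxE.
Qed.

Lemma is_derive_row_mx m p q (a : V -> 'M[R]_(m, p)) (b : V -> 'M[R]_(m, q))
    (x v : V) da db :
  is_derive x v a da -> is_derive x v b db ->
  is_derive x v (fun y => row_mx (a y) (b y)) (row_mx da db).
Proof.
move=> /is_derive_mxP ha /is_derive_mxP hb; apply/is_derive_mxP => i j.
rewrite mxE; under eq_fun do rewrite mxE.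
by case: (fintype.split j).
Qed.

Lemma is_derive_mxform n (A : V -> 'M[R]_n) (a b : V -> 'rV[R]_n) (x v : V)
    dA da db :
  is_derive x v A dA -> is_derive x v a da -> is_derive x v b db ->
  is_derive x v (fun y => mxform (A y) (a y) (b y))
    (mxform dA (a x) (b x) + mxform (A x) da (b x) + mxform (A x) (a x) db).
Proof.
move=> hA ha hb.
have /is_derive_mxP/(_ 0 0) :=
  is_derive_mulmx (is_derive_mulmx ha hA) (is_derive_trmx hb).
move=> h; apply: (is_derive_eq h).
by rewrite mulmxDl [LHS]mxE [X in X + _]mxE [mxform dA _ _ + _]addrC.
Qed.

Lemma is_derive_comp_diff (W X : normedModType R) (f : V -> W) (g : W -> X)
    (x v : V) (df : W) :
  differentiable f x -> differentiable g (f x) -> is_derive x v f df ->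
  is_derive x v (g \o f) ('D_df g (f x)).
Proof.
move=> fx gfx [_ <-].
have gf : differentiable (g \o f) x by exact: differentiable_comp.
apply: DeriveDef; first exact: diff_derivable.
by rewrite !deriveE// diff_comp.
Qed.

(** Turns a directional derivative into an ordinary derivative at [0], to which the one-variable
    chain rule applies. *)
Lemma is_derive_line (W : normedModType R) (f : V -> W) (x v : V) (d : W) :
  is_derive x v f d -> is_derive (0 : R) 1 (fun t : R => f (t *: v + x)) d.
Proof.
move=> [fx <-]; apply: DeriveDef; first exact: (derivable1P f x v).1.
rewrite /derive; set g1 := fun h => h^-1 *: _; set g2 := fun h => h^-1 *: _.
suff -> : g1 = g2 by [].
by apply/funext => t; rewrite /g1 /g2 /= addr0 scale0r add0r [_%:A]mulr1.
Qed.

Lemma row_mx_splitE m p q (a : 'M[R]_(m, p)) (b : 'M[R]_(m, q)) :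
  row_mx a b = a *m row_mx 1%:M 0 + b *m row_mx 0 1%:M.
Proof. by rewrite !mul_mx_row !mulmx1 !mulmx0 add_row_mx add0r addr0. Qed.

End DeriveMatrix.

Section Linear.
Variable R : realType.

(** In finite dimension a linear map is a finite combination of coordinate functions. *)
Lemma linear_rV_differentiable n (V : normedModType R)
    (f : {linear 'rV[R]_n -> V}) x : differentiable f x.
Proof.
have -> : (f : _ -> V) = \sum_i (fun y : 'rV[R]_n => y 0 i *: f (delta_mx 0 i)).
  apply/funext => y; rewrite fct_sumE {1}(row_sum_delta y) linear_sum.
  by apply: eq_bigr => i _; rewrite linearZ.
apply: differentiable_sum => i; apply: differentiableZl.
exact: differentiable_coord.
Qed.

End Linear.

(** * The computation in a chart *)

Section Koszul.
Variables (R : realType) (n : nat) (h : 'rV[R]_n -> 'M[R]_n).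

Lemma christoffelZl x a u v :
  christoffel h x (a *: u) v = a *: christoffel h x u v.
Proof.
apply/rowP => k; rewrite !mxE mulr_sumr; apply: eq_bigr => i _.
rewrite mulr_sumr; apply: eq_bigr => j _; rewrite mxE; ring.
Qed.

Lemma christoffelZr x a u v :
  christoffel h x u (a *: v) = a *: christoffel h x u v.
Proof.
apply/rowP => k; rewrite !mxE mulr_sumr; apply: eq_bigr => i _.
rewrite mulr_sumr; apply: eq_bigr => j _; rewrite mxE; ring.
Qed.

Lemma christoffel0l x v : christoffel h x 0 v = 0.
Proof.
by rewrite -[X in christoffel h x X v](scale0r 0) christoffelZl scale0r.
Qed.

Lemma derive_rVE (V : normedModType R) (f : 'rV[R]_n -> V) x u :
  differentiable f x -> 'D_u f x = \sum_i u 0 i *: 'D_(delta_mx 0 i) f x.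
Proof.
move=> df; rewrite deriveE// [in LHS](row_sum_delta u) linear_sum.
by apply: eq_bigr => i _; rewrite linearZ/= deriveE//.
Qed.

Lemma is_derive_entries x u :
  (forall i j, differentiable (fun y => h y i j) x) ->
  is_derive x u h ('D_u h x).
Proof.
move=> dh; apply: derivableP; apply/derivable_mxP => i j.
exact: diff_derivable.
Qed.

Lemma derive_entries x u i j :
  (forall i j, differentiable (fun y => h y i j) x) ->
  'D_u h x i j = \sum_k u 0 k * partial h k i j x.
Proof.
move=> dh; have [hx _] := is_derive_entries u dh.
by rewrite derive_mx// mxE (derive_rVE u (dh i j)).
Qed.

(** Koszul formula for constant fields, whose brackets vanish: pairing with [h x] cancels the
    inverse matrix in the Christoffel symbols, and differentiability turns the sums of partial
    derivatives into directional ones. *)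
Lemma christoffel_koszul x u v w :
  (h x)^T = h x -> h x \in unitmx ->
  (forall i j, differentiable (fun y => h y i j) x) ->
  mxform (h x) (christoffel h x u v) w =
  2^-1 * (mxform ('D_u h x) v w + mxform ('D_v h x) u w
          - mxform ('D_w h x) u v).
Proof.
move=> hs hU dh.
pose T i j l := partial h i j l x + partial h j i l x - partial h l i j x.
(* [t] is twice the covector obtained from [christoffel h x u v] by lowering its index. *)
pose t : 'rV[R]_n := \row_l \sum_i \sum_j T i j l * u 0 i * v 0 j.
have -> : christoffel h x u v = 2^-1 *: (t *m (invmx (h x))).
  apply/rowP => k; rewrite !mxE mulr_sumr.
  under [RHS]eq_bigr => l _ do rewrite mxE mulrA mulr_sumr mulr_suml.
  rewrite [RHS]exchange_big; apply: eq_bigr => i _.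
  under [RHS]eq_bigr => l _ do rewrite mulr_sumr mulr_suml.
  rewrite [RHS]exchange_big; apply: eq_bigr => j _.
  rewrite /christoffel_symbol mulr_sumr !mulr_suml; apply: eq_bigr => l _.
  have -> : invmx (h x) k l = invmx (h x) l k.
    by rewrite -[in LHS]hs -trmx_inv mxE.
  by rewrite /T; ring.
rewrite mxformZl; congr (_ * _).
transitivity (\sum_l \sum_i \sum_j T i j l * u 0 i * v 0 j * w 0 l).
  rewrite /mxform mulmxKV// mxE.
  apply: eq_bigr => l _; rewrite !mxE mulr_suml; apply: eq_bigr => i _.
  by rewrite mulr_suml.
have -> : mxform ('D_u h x) v w =
    \sum_l \sum_i \sum_j partial h i j l x * u 0 i * v 0 j * w 0 l.
  rewrite mxformE exchange_big; apply: eq_bigr => l _; rewrite exchange_big.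
  apply: eq_bigr => j _; rewrite derive_entries// mulr_sumr mulr_suml.
  by apply: eq_bigr => i _; ring.
have -> : mxform ('D_v h x) u w =
    \sum_l \sum_i \sum_j partial h j i l x * u 0 i * v 0 j * w 0 l.
  rewrite mxformE exchange_big; apply: eq_bigr => l _; apply: eq_bigr => i _.
  rewrite derive_entries// mulr_sumr mulr_suml.
  by apply: eq_bigr => j _; ring.
have -> : mxform ('D_w h x) u v =
    \sum_l \sum_i \sum_j partial h l i j x * u 0 i * v 0 j * w 0 l.
  rewrite mxformE [RHS]exchange_big; apply: eq_bigr => i _.
  rewrite [RHS]exchange_big; apply: eq_bigr => j _.
  rewrite derive_entries// mulr_sumr mulr_suml.
  by apply: eq_bigr => l _; ring.
rewrite -big_split/= -sumrB; apply: eq_bigr => l _.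
rewrite -big_split/= -sumrB; apply: eq_bigr => i _.
rewrite -big_split/= -sumrB; apply: eq_bigr => j _.
by rewrite /T; ring.
Qed.

End Koszul.

Lemma differentiable_row_mx (R : realType) (V : normedModType R) p q
    (a : V -> 'rV[R]_p) (b : V -> 'rV[R]_q) x :
  differentiable a x -> differentiable b x ->
  differentiable (fun y => row_mx (a y) (b y)) x.
Proof.
move=> da db.
have -> : (fun y => row_mx (a y) (b y)) =
    (mulmxr (row_mx 1%:M 0 : 'M[R]_(p, p + q)) \o a) +
    (mulmxr (row_mx 0 1%:M : 'M[R]_(q, p + q)) \o b).
  by apply/funext => y; rewrite row_mx_splitE.
apply: differentiableD; apply: differentiable_comp => //;
  exact: linear_rV_differentiable.
Qed.

Section KaluzaKleinChart.
(* [h] is the matrix of [g] in a chart [U] and [H] that of the metric of the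
   tangent bundle in the induced chart; [S] is the vector field and [k] its
   squared norm.  In [H_kk], [a + christoffel h x u y] is the vertical part of
   [row_mx u a], so [H_kk] sums up the three equations of a Kaluza-Klein metric
   with [A = 1]. *)
Variables (R : realType) (n : nat) (U : set 'rV[R]_n) (h : 'rV[R]_n -> 'M[R]_n).
Variables (H : 'rV[R]_(n + n) -> 'M[R]_(n + n)) (S : 'rV[R]_n -> 'rV[R]_n).
Variables (B C : R -> R) (k : R).

(** This is also the vertical part of [row_mx v ('D_v S x)], the image of [v] under the differential
    of the section. *)
Definition nabla (v x : 'rV[R]_n) := 'D_v S x + christoffel h x v (S x).
Definition graph (x : 'rV[R]_n) : 'rV[R]_(n + n) := row_mx x (S x).

Hypothesis U_open : open U.
Hypothesis h_sym : forall x, U x -> (h x)^T = h x.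
Hypothesis h_unit : forall x, U x -> h x \in unitmx.
Hypothesis h_diff : forall x, U x -> forall i j,
  differentiable (fun y => h y i j) x.
Hypothesis S_diff : forall x, U x -> differentiable S x.
Hypothesis S_norm : forall x, U x -> mxform (h x) (S x) (S x) = k.
Hypothesis H_kk : forall x y u v a b, U x ->
  let q := mxform (h x) y y in
  let a' := a + christoffel h x u y in
  let b' := b + christoffel h x v y in
  mxform (H (row_mx x y)) (row_mx u a) (row_mx v b) =
  mxform (h x) u v + B q * mxform (h x) a' b' +
  C q * mxform (h x) a' y * mxform (h x) b' y.

(** Differentiate the constant norm. In the Koszul formula with both last arguments [S x], two terms
    cancel, and the remaining half of ['D_v h] accounts for the variation of the metric. *)
Lemma nabla_orthogonal x v : U x -> mxform (h x) (nabla v x) (S x) = 0.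
Proof.
move=> Ux.
have dS := derivableP (@diff_derivable _ _ _ S x v (S_diff Ux)).
have dh := is_derive_entries v (h_diff Ux).
have [_ hk] := is_derive_mxform dh dS dS.
have : 'D_v (fun y => mxform (h y) (S y) (S y)) x = 'D_v (cst k) x.
  apply: near_eq_derive; near=> y; rewrite S_norm//; near: y.
  exact: open_nbhs_nbhs.
rewrite hk derive_cst => E.
rewrite /nabla mxformDl.
rewrite christoffel_koszul; [|exact: h_sym|exact: h_unit|exact: h_diff].
move: E; rewrite (mxformC (S x) ('D_v S x) (h_sym Ux)).
move: (mxform (h x) ('D_v S x) (S x)) (mxform ('D_v h x) (S x) (S x)) => a b.
move: (mxform ('D_(S x) h x) v (S x)) => c.
by lra.
Unshelve. all: by end_near. Qed.

Lemma is_derive_graph x v : U x -> is_derive x v graph (row_mx v ('D_v S x)).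
Proof.
move=> Ux; apply: (is_derive_row_mx (is_derive_id x v)).
exact: derivableP (@diff_derivable _ _ _ S x v (S_diff Ux)).
Qed.

Lemma graph_diff x : U x -> differentiable graph x.
Proof. by move=> Ux; apply: differentiable_row_mx => //; exact: S_diff. Qed.

(** The Euler vector [row_mx 0 (S x)] has no horizontal part, and the [B] and [C] terms of [H_kk]
    both contain the product of [nabla v x] with [S x]. *)
Lemma graph_orthogonal x v : U x ->
  mxform (H (graph x)) (row_mx v ('D_v S x)) (row_mx 0 (S x)) = 0.
Proof.
move=> Ux; rewrite /graph H_kk// christoffel0l addr0 mxform0r.
by rewrite -/(nabla v x) nabla_orthogonal// !mulr0 mul0r !addr0.
Qed.

Section AtPoint.
Variables (x : 'rV[R]_n) (B' C' : R).
Hypothesis Ux : U x.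
Hypothesis S_diff2 : forall v, differentiable (fun y => 'D_v S y) x.
Hypothesis H_sym : (H (graph x))^T = H (graph x).
Hypothesis H_unit : H (graph x) \in unitmx.
Hypothesis H_diff : forall i j, differentiable (fun z => H z i j) (graph x).
Hypothesis B_derive : is_derive k 1 B B'.
Hypothesis C_derive : is_derive k 1 C C'.

Let V := row_mx (0 : 'rV[R]_n) (S x).

(* On the dilation [t |-> (x, (1 + t) *: S x)] the metric is explicit in [t], and
   its [C] term is of order [t ^+ 2] since [nabla] is orthogonal to [S]. *)
Lemma derive_vertical_metric u v :
  let a := row_mx u ('D_u S x) in let b := row_mx v ('D_v S x) in
  mxform ('D_V H (graph x)) a b =
  2 * k * B' * mxform (h x) (nabla u x) (nabla v x) +
  B k * (mxform (h x) (christoffel h x u (S x)) (nabla v x) +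
         mxform (h x) (nabla u x) (christoffel h x v (S x))).
Proof.
move=> a b.
have dH := is_derive_entries V H_diff.
have := is_derive_mxform dH (is_derive_cst a _ _) (is_derive_cst b _ _).
rewrite mxform0l mxform0r !addr0 => /is_derive_line [_ <-].
set gu := christoffel h x u (S x); set gv := christoffel h x v (S x).
(* [q t] is the squared norm of [(1 + t) *: S x]. In [f], [wu] and [wv] are the vertical parts at
   [t = 0], and [du], [dv] their rates of change, constant because the connection is linear in the
   fibre variable. *)
pose q (t : R) := (1 + t) ^+ 2 * k.
pose f (t : R) (A : 'M[R]_n) (wu wv du dv s : 'rV[R]_n) := mxform A u v
  + B (q t) * (mxform A wu wv + t * (mxform A du wv + mxform A wu dv) +
               t ^+ 2 * mxform A du dv)
  + C (q t) * (t ^+ 2 * ((1 + t) ^+ 2 * mxform A du s * mxform A dv s)).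
have fE t (A : 'M[R]_n) (wu wv du dv s : 'rV[R]_n) :
    mxform A s s = k -> mxform A wu s = 0 -> mxform A wv s = 0 ->
    mxform A u v +
    B (mxform A ((1 + t) *: s) ((1 + t) *: s)) *
      mxform A (wu + t *: du) (wv + t *: dv) +
    C (mxform A ((1 + t) *: s) ((1 + t) *: s)) *
      mxform A (wu + t *: du) ((1 + t) *: s) *
      mxform A (wv + t *: dv) ((1 + t) *: s) = f t A wu wv du dv s.
  move=> sk us vs; rewrite !mxformDl !mxformDr !mxformZl !mxformZr sk us vs.
  by rewrite /f /q expr2 -!mulrA; ring.
have -> : (fun t : R => mxform (H (t *: V + graph x)) a b) =
    fun t => f t (h x) (nabla u x) (nabla v x) gu gv (S x).
  apply/funext => t.
  have -> : t *: V + graph x = row_mx x ((1 + t) *: S x).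
    by rewrite scale_row_mx scaler0 add_row_mx add0r scalerDl scale1r addrC.
  have E w : 'D_w S x + christoffel h x w ((1 + t) *: S x) =
      nabla w x + t *: christoffel h x w (S x).
    by rewrite christoffelZr scalerDl scale1r addrA.
  by rewrite /a /b H_kk//= !E fE// ?S_norm// nabla_orthogonal.
rewrite /f.
move: (h x) (nabla u x) (nabla v x) gu gv (S x) => A wu wv du dv s.
(* The dilation changes the squared norm at the rate [2 * k]; this is how [B'] enters. *)
have dq : is_derive (0 : R) 1 q (2 * k).
  by apply: is_derive_eq; rewrite /GRing.scale/=; ring.
have q0 : q 0 = k by rewrite /q addr0 expr1n mul1r.
have dBq : is_derive (0 : R) 1 (B \o q) (B' * (2 * k)).
  by apply: is_derive1_comp; rewrite q0.
have dCq : is_derive (0 : R) 1 (C \o q) (C' * (2 * k)).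
  by apply: is_derive1_comp; rewrite q0.
suff [_ ->] : is_derive (0 : R) 1 (fun t : R => mxform A u v +
    (B \o q) t * (mxform A wu wv + t * (mxform A du wv + mxform A wu dv) +
      t ^+ 2 * mxform A du dv) +
    (C \o q) t * (t ^+ 2 * ((1 + t) ^+ 2 * mxform A du s * mxform A dv s)))
  (2 * k * B' * mxform A wu wv + B k * (mxform A du wv + mxform A wu dv)) by [].
move: (mxform A u v) (mxform A wu wv) (mxform A du wv + mxform A wu dv).
move: (mxform A du dv) (mxform A du s) (mxform A dv s) => c1 c2 c3 c4 c5 c6.
apply: is_derive_eq; rewrite /= q0 /GRing.scale/=; ring.
Qed.

Lemma is_derive_metric_graph v :
  is_derive x v (H \o graph) ('D_(row_mx v ('D_v S x)) H (graph x)).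
Proof.
have [H1 _] := is_derive_entries (row_mx v ('D_v S x)) H_diff.
apply/is_derive_mxP => i j; rewrite derive_mx// mxE.
apply: (is_derive_comp_diff (g := fun z => H z i j)) => //.
- exact: graph_diff.
- exact: is_derive_graph.
Qed.

(* This is [graph_orthogonal] differentiated in the direction [u]. *)
Lemma derive_graph_orthogonal u v :
  let a := row_mx u ('D_u S x) in let b := row_mx v ('D_v S x) in
  mxform ('D_a H (graph x)) b V =
  - mxform (H (graph x)) (row_mx 0 ('D_u (fun y => 'D_v S y) x)) V
  - B k * (mxform (h x) (nabla v x) (nabla u x) -
           mxform (h x) (nabla v x) (christoffel h x u (S x))).
Proof.
move=> a b.
have db : is_derive x u (fun y => row_mx v ('D_v S y))
    (row_mx 0 ('D_u (fun y => 'D_v S y) x)).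
  apply: (is_derive_row_mx (is_derive_cst v x u)).
  exact: derivableP (@diff_derivable _ _ _ _ x u (S_diff2 v)).
have dV : is_derive x u (fun y => row_mx (0 : 'rV[R]_n) (S y))
    (row_mx 0 ('D_u S x)).
  apply: (is_derive_row_mx (is_derive_cst (0 : 'rV[R]_n) x u)).
  exact: derivableP (@diff_derivable _ _ _ S x u (S_diff Ux)).
have [_ hW] := is_derive_mxform (is_derive_metric_graph u) db dV.
have : 'D_u (fun y => mxform ((H \o graph) y) (row_mx v ('D_v S y))
    (row_mx 0 (S y))) x = 'D_u (cst (0 : R)) x.
  apply: near_eq_derive; near=> y; apply: graph_orthogonal; near: y.
  exact: open_nbhs_nbhs.
rewrite hW derive_cst -/a -/b -/V /=.
(* The Euler field varies along the section by the vertical vector ['D_u S x], which is [nabla u x]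
   minus its Christoffel term. *)
have -> : mxform (H (graph x)) b (row_mx 0 ('D_u S x)) =
    B k * (mxform (h x) (nabla v x) (nabla u x) -
           mxform (h x) (nabla v x) (christoffel h x u (S x))).
  rewrite /b /graph H_kk//= christoffel0l addr0 mxform0r S_norm//.
  rewrite -/(nabla v x) nabla_orthogonal// mulr0 mul0r addr0 add0r.
  rewrite -mxformNr -mxformDr; congr (_ * mxform _ _ _).
  by rewrite /nabla addrK.
move=> E; apply/eqP; rewrite -subr_eq0 -E; apply/eqP.
by rewrite opprB opprK addrCA addrA; ring.
Unshelve. all: by end_near. Qed.

(** Apply the Koszul formula for [H] to [a], [b], [V]: two terms come from the differentiated
    orthogonality, the third from the dilation, and the Christoffel products cancel. The term in [w]
    is tangent to the section, hence orthogonal to [V]. The antisymmetric difference of second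
    derivatives is kept, since it disappears in the trace. *)
Lemma second_fundamental_form_vertical u v w :
  let a := row_mx u ('D_u S x) in let b := row_mx v ('D_v S x) in
  let E c d := mxform (H (graph x)) (row_mx 0 ('D_c (fun y => 'D_d S y) x)) V in
  mxform (H (graph x))
    (row_mx 0 ('D_u (fun y => 'D_v S y) x) - row_mx w ('D_w S x)
     + christoffel H (graph x) a b) V =
  2^-1 * (E u v - E v u)
  - (B k + k * B') * mxform (h x) (nabla u x) (nabla v x).
Proof.
move=> a b E.
have D (A : 'M[R]_(n + n)) (z1 z2 z3 z : 'rV[R]_(n + n)) :
    mxform A (z1 - z2 + z3) z = mxform A z1 z - mxform A z2 z + mxform A z3 z.
  by rewrite !mxformDl mxformNl.
have alg (e1 e2 z2 z3 d1 d2 d3 m m' g1 g1' g2 g2' : R) :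
    z2 = 0 -> z3 = 2^-1 * (d1 + d2 - d3) ->
    d1 = - e1 - B k * (m' - g1') -> d2 = - e2 - B k * (m - g2) ->
    d3 = 2 * k * B' * m + B k * (g1 + g2) -> m' = m -> g1' = g1 ->
    e1 - z2 + z3 = 2^-1 * (e1 - e2) - (B k + k * B') * m.
  by move=> -> -> -> -> -> -> ->; field.
apply: etrans (D _ _ _ _ _) _.
exact: (alg _ _ _ _ _ _ _ _ _ _ _ _ _ (graph_orthogonal w Ux)
  (christoffel_koszul a b V H_sym H_unit H_diff)
  (derive_graph_orthogonal u v) (derive_graph_orthogonal v u)
  (derive_vertical_metric u v) (mxformC (nabla v x) (nabla u x) (h_sym Ux))
  (mxformC (nabla v x) (christoffel h x u (S x)) (h_sym Ux))).
Qed.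

End AtPoint.
End KaluzaKleinChart.

(** * Positive definite matrices *)

Section PositiveDefinite.
Variables (R : rcfType) (n : nat) (h : 'M[R]_n).
Hypothesis h_pos : forall v, v != 0 -> 0 < mxform h v v.

(** A nonzero vector in the kernel would have norm zero. *)
Lemma posdef_unitmx : h \in unitmx.
Proof.
rewrite -row_free_unit -kermx_eq0; apply/negPn/negP => ker_neq0.
have /h_pos : nz_row (kermx h) != 0 by rewrite nz_row_eq0.
have /sub_kermxP hv : (nz_row (kermx h) <= kermx h)%MS by exact: nz_row_sub.
by rewrite /mxform hv mul0mx mxE ltxx.
Qed.

Hypothesis h_sym : h^T = h.

(** Gram-Schmidt: the rows of [E] are orthonormal for [h], and one row is added at each step. *)
Lemma posdef_orthonormal m : (m <= n)%N ->
  exists E : 'M[R]_(m, n), E *m h *m E^T = 1%:M.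
Proof.
elim: m => [_|m IH mn]; first by exists 0; apply/matrixP; case.
have [E hE] := IH (ltnW mn).
(* [v] is orthogonal to the rows of [E]. It is nonzero because [h *m E^T] has only [m < n] columns,
   so its left kernel is nontrivial. *)
pose v := nz_row (kermx (h *m E^T)).
have v0 : v != 0.
  rewrite nz_row_eq0 -mxrank_eq0 mxrank_ker.
  by rewrite subn_eq0 -ltnNge (leq_ltn_trans (rank_leq_col _)).
have vE : v *m h *m E^T = 0.
  by rewrite -mulmxA; apply/sub_kermxP; exact: nz_row_sub.
pose e := (Num.sqrt (mxform h v v))^-1 *: v.
have eE : e *m h *m E^T = 0 by rewrite -!scalemxAl vE scaler0.
have Ee : E *m h *m e^T = 0.
  by apply: trmx_inj; rewrite !trmx_mul trmxK h_sym mulmxA eE trmx0.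
have ee : e *m h *m e^T = 1%:M.
  have hv := h_pos v0; apply/matrixP => i j.
  rewrite !ord1 [RHS]mxE eqxx; apply: (etrans (mxformZl _ _ _ _)).
  rewrite mxformZr mulrA -invfM -expr2 sqr_sqrtr ?ltW// mulVf//.
  exact: lt0r_neq0.
suff : col_mx e E *m h *m (col_mx e E)^T = 1%:M by exists (col_mx e E).
by rewrite tr_col_mx mul_col_mx mul_col_row eE Ee ee hE -scalar_mx_block.
Qed.

(** In an orthonormal frame the trace is a sum of squared norms, so every term vanishes; the frame
    being invertible, so does every [w i]. *)
Lemma trace_mxform_eq0 (w : 'I_n -> 'rV[R]_n) :
  \sum_i \sum_j invmx h i j * mxform h (w i) (w j) = 0 -> forall i, w i = 0.
Proof.
have [E hE] := posdef_orthonormal (leqnn n).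
have EU : E \in unitmx.
  by rewrite -mulmxA in hE; have [] := mulmx1_unit hE.
have hEE : invmx h = E^T *m E.
  have hU := posdef_unitmx.
  rewrite -[RHS](mulmxK hU).
  (* [E *m h] is a left inverse of the square matrix [E^T], hence also a right inverse. *)
  have -> : E^T *m E *m h = 1%:M; last by rewrite mul1mx.
  by rewrite -mulmxA; apply: mulmx1C.
pose e a := \sum_i E a i *: w i.
have -> : \sum_i \sum_j invmx h i j * mxform h (w i) (w j) =
    \sum_a mxform h (e a) (e a).
  rewrite hEE.
  transitivity (\sum_i \sum_j \sum_a E a i * E a j * mxform h (w i) (w j)).
    apply: eq_bigr => i _; apply: eq_bigr => j _; rewrite mxE mulr_suml.
    by apply: eq_bigr => a _; rewrite mxE.
  rewrite [RHS](eq_bigr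
    (fun a => \sum_i \sum_j E a i * E a j * mxform h (w i) (w j))).
    rewrite [RHS]exchange_big; apply: eq_bigr => i _.
    by rewrite [RHS]exchange_big.
  move=> a _; rewrite mxform_suml; apply: eq_bigr => i _.
  rewrite (mxformC _ _ h_sym) mxform_suml; apply: eq_bigr => j _.
  by rewrite mxformZl mxformZr (mxformC _ _ h_sym); ring.
have pos v : 0 <= mxform h v v.
  by have [->|/h_pos/ltW//] := eqVneq v 0; rewrite mxform0l.
move=> /eqP; rewrite psumr_eq0// => /allP e0.
(* With the [w i] as rows of [W], the vectors [e a] are the rows of [E *m W]. *)
pose W : 'M[R]_n := \matrix_i w i.
have EW : E *m W = 0.
  apply/row_matrixP => a; rewrite row0 row_mul mulmx_sum_row.
  transitivity (e a).
    by apply: eq_bigr => i _; rewrite rowK mxE.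
  apply: contraTeq (e0 a (mem_index_enum _)) => /h_pos.
  by move=> /lt0r_neq0.
move=> i; have := congr1 (row i) (congr1 (mulmx (invmx E)) EW).
by rewrite mulKmx// mulmx0 row0 rowK.
Qed.

End PositiveDefinite.

(** * Differentials of local inverses, and derivatives on the half-line *)

Section SmoothCharts.
Local Open Scope classical_set_scope.
Variables (R : realType).

Lemma diff_id_near (V : normedModType R) (f : V -> V) x v :
  (\near x, f x = x) -> 'D_v f x = v.
Proof. by move=> /(@near_eq_derive _ _ _ f id) ->; rewrite derive_id. Qed.

(** The first-order remainder vanishes identically near [x], so the identity satisfies the
    definition of the differential. *)
Lemma diff_near_id (V : normedModType R) (f : V -> V) x :
  (\near x, f x = x) -> 'd f x = id :> (V -> V).
Proof.
move=> fx; have fxx := nbhs_singleton fx.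
apply: (@diff_unique _ _ _ f idfun); first by move=> y; exact: cvg_id.
apply/eqaddoP => e e0; have := fx; rewrite (near_shift (0 : V)) /= subr0.
apply: filterS => y /= fyx.
rewrite -![(_ + _ : _ -> _) _]/(_ + _) -![(- _ : _ -> _) _]/(- _).
rewrite /= fyx fxx /cst /=.
rewrite -[(_ + idfun) y]/(x + y) [x + y]addrC subrr normr0.
by rewrite mulr_ge0// ltW.
Qed.

Lemma diff_cancel (V W : normedModType R) (f : V -> W) (g : W -> V) x v :
  differentiable f x -> differentiable g (f x) -> (\near x, g (f x) = x) ->
  'd g (f x) ('d f x v) = v.
Proof.
move=> df dg fg.
have dgf : differentiable (g \o f) x by exact: differentiable_comp.
have := diff_id_near v fg.
by rewrite (deriveE _ dgf) diff_comp.
Qed.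

(** At an interior point all small increments stay in the half-line, so the restricted difference
    quotient has the two-sided limit. *)
Lemma halfline_is_derive (f : R -> R) (t : R) : 0 < t ->
  cvg (halfline_quotient f t) -> is_derive t 1 f (halfline_derive f t).
Proof.
move=> t0 /cvgrPdist_le fl.
have H : (h^-1 *: (f (h *: 1 + t) - f t)) @[h --> 0^'] -->
    halfline_derive f t.
  apply/cvgrPdist_le => e e0; have [r/= r0 fr] := fl e e0.
  near=> s; have s0 : s != 0 by near: s; exact: nbhs_dnbhs_neq.
  have sr : `|s| < r by near: s; exact: dnbhs0_lt.
  have st : `|s| < t by near: s; exact: dnbhs0_lt.
  have := fr (s + t); rewrite /= addrK [s *: 1]mulr1 [_^-1 *: _]mulrC.
  apply.
  - by rewrite /ball/= opprD addrCA subrr addr0 normrN.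
  - by rewrite -subr_eq0 addrK.
  - by move: st; rewrite ltr_norml => /andP[]; lra.
by apply: DeriveDef; [apply/cvg_ex; exists (halfline_derive f t)|exact/cvg_lim].
Unshelve. all: by end_near. Qed.

End SmoothCharts.

(** * From charts to the manifold *)

Section MetricInChart.
Variables (R : realType) (N : atlas R) (m : metric N).
Hypothesis m_linear : forall (p : N) (a : R) (u v w : 'rV[R]_(dim N)),
  m p (a *: u + v) w = a * m p u w + m p v w.
Hypothesis m_sym : forall (p : N) (u v : 'rV[R]_(dim N)), m p u v = m p v u.

Lemma metric_sumZl I (r : seq I) (a : I -> R) (f : I -> 'rV[R]_(dim N)) p w :
  m p (\sum_(i <- r) a i *: f i) w = \sum_(i <- r) a i * m p (f i) w.
Proof.
elim: r => [|i r IH]; last by rewrite !big_cons m_linear IH.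
rewrite !big_nil; have := m_linear p 1 0 0 w.
by rewrite scale1r addr0 mul1r => E; apply: (addrI (m p 0 w)); rewrite -E addr0.
Qed.

Lemma mxform_metric_mx c x u v :
  mxform (metric_mx m c x) u v =
  m (psi c x) (of_coords c (psi c x) u) (of_coords c (psi c x) v).
Proof.
have E w : of_coords c (psi c x) w =
    \sum_i w 0 i *: of_coords c (psi c x) (delta_mx 0 i).
  rewrite [in LHS](row_sum_delta w) /of_coords linear_sum.
  by apply: eq_bigr => i _; rewrite linearZ.
rewrite mxformE (E u) metric_sumZl; apply: eq_bigr => i _.
rewrite (E v) m_sym metric_sumZl mulr_sumr; apply: eq_bigr => j _.
by rewrite mxE m_sym [_ * v 0 j]mulrC mulrCA.
Qed.

Lemma metric_mx_sym c x : (metric_mx m c x)^T = metric_mx m c x.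
Proof. by apply/matrixP => i j; rewrite !mxE m_sym. Qed.

End MetricInChart.

(** * Chart changes on the manifold and on its tangent bundle *)

Section Charts.
Local Open Scope classical_set_scope.
Variables (R : realType) (M : atlas R).
Hypothesis M_smooth : smooth_manifold M.

Lemma open_chart (c : index M) : open (phi c @` dom c).
Proof. by have := @open_overlap _ _ M_smooth c c; rewrite setIid. Qed.

Lemma psi_image (c : index M) x : (phi c @` dom c) x ->
  dom c (psi c x) /\ phi c (psi c x) = x.
Proof. by case=> p pc <-; rewrite (phiK M_smooth). Qed.

Lemma transition_diff (c d : index M) p : dom c p -> dom d p ->
  differentiable (phi d \o psi c) (phi c p).
Proof.
move=> cp dp; have [+ _] := @smooth_transition _ _ M_smooth c d 1.
by apply; exists p.
Qed.

(** Opposite chart changes are mutually inverse on the open image of the overlap, so the chain rule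
    applies. *)
Lemma transition_cancel (c d : index M) p v : dom c p -> dom d p ->
  'd (phi c \o psi d) (phi d p) ('d (phi d \o psi c) (phi c p) v) = v.
Proof.
move=> cp dp.
have e : (phi d \o psi c) (phi c p) = phi d p by rewrite /= (phiK M_smooth).
rewrite -[X in 'd _ X _]e; apply: diff_cancel.
- exact: transition_diff.
- by rewrite e; exact: transition_diff.
- have : nbhs (phi c p) (phi c @` (dom c `&` dom d)).
    apply: open_nbhs_nbhs; split; first exact: (open_overlap M_smooth).
    by exists p.
  by apply: filterS => _ [q [qc qd] <-] /=; rewrite !(phiK M_smooth).
Qed.

Lemma of_coordsK (c : index M) p v :
  dom c p -> coords c p (of_coords c p v) = v.
Proof. by move=> cp; apply: transition_cancel => //; exact: dom_chart_at. Qed.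

Lemma coordsK (c : index M) p v :
  dom c p -> of_coords c p (coords c p v) = v.
Proof. by move=> cp; apply: transition_cancel => //; exact: dom_chart_at. Qed.

Lemma phi_psi_bundle (c : index M) x y : (phi c @` dom c) x ->
  phi (a := tangent_bundle M) c (psi (a := tangent_bundle M) c (row_mx x y)) =
  row_mx x y.
Proof.
move=> /psi_image[cx xE] /=.
by rewrite row_mxKl row_mxKr xE of_coordsK.
Qed.

(** When [c] is the preferred chart, the change of components is the differential of a map equal to
    the identity near the point. This case suffices, as the tension field is computed in preferred
    charts. *)
Lemma of_coords_bundle (c : index M) x y a : (phi c @` dom c) x ->
  chart_at (psi c x) = c ->
  of_coords (M := tangent_bundle M) c
    (psi (a := tangent_bundle M) c (row_mx x y)) a = a.
Proof.
move=> cx xc; rewrite /of_coords.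
rewrite (phi_psi_bundle y cx).
have -> : chart_at (psi (a := tangent_bundle M) c (row_mx x y)) = c.
  by rewrite /= row_mxKl.
have near_id : \forall z \near row_mx x y,
    (phi (a := tangent_bundle M) c \o psi (a := tangent_bundle M) c) z = z.
  have /= lx := @continuous_lsubmx R 1 (dim M) (dim M) (row_mx x y).
  have : nbhs (lsubmx (row_mx x y)) (phi c @` dom c).
    by rewrite row_mxKl; apply: open_nbhs_nbhs; split => //; exact: open_chart.
  move=> /lx near_c.
  apply: (@filterS _ (nbhs (row_mx x y)) (nbhs_filter _) _ _ _ near_c).
  move=> z /= cz.
  by rewrite -[z in RHS]hsubmxK -(phi_psi_bundle _ cz) hsubmxK.
by rewrite (diff_near_id near_id).
Qed.

End Charts.

(** * The section and the Kaluza-Klein metric in one chart *)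

Section Assembly.
Local Open Scope classical_set_scope.
Variables (R : realType) (M : atlas R) (g : metric M) (B C : R -> R).
Variables (G : metric (tangent_bundle M)) (sigma : vector_field M) (k : R).
Hypothesis M_smooth : smooth_manifold M.
Hypothesis g_riem : riemannian g.
Hypothesis G_kk : kaluza_klein g (fun=> 1) B C G.
Hypothesis sigma_smooth : smooth_vector_field sigma.
Hypothesis sigma_norm : forall p, g p (sigma p) (sigma p) = k.

Let TM := tangent_bundle M.
Let g_lin := metric_linear (g_riem 0).
Let g_sym := metric_sym (g_riem 0).
Let g_pos := metric_pos (g_riem 0).
Let G_lin := metric_linear (kk_riemannian G_kk).
Let G_sym := metric_sym (kk_riemannian G_kk).
Let G_pos := metric_pos (kk_riemannian G_kk).

Variable c : index M.
Local Notation U := (phi c @` dom c).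
Let h := metric_mx g c.
Let H := metric_mx G (c : index TM).

Definition local_field (x : 'rV[R]_(dim M)) :=
  coords c (psi c x) (sigma (psi c x)).
Local Notation S := local_field.

Lemma chart_metric_pos x v : U x -> v != 0 -> 0 < mxform (h x) v v.
Proof.
move=> /(psi_image M_smooth)[cx _] v0; rewrite /h mxform_metric_mx//.
apply: g_pos.
apply: contra_neq v0 => E.
by rewrite -(of_coordsK M_smooth v cx) E /coords linear0.
Qed.

Lemma chart_metric_diff x : U x ->
  forall i j, differentiable (fun y => h y i j) x.
Proof. by move=> Ux i j; have [+ _] := metric_Ck (g_riem 1) c i j; exact. Qed.

Lemma local_field_diff x : U x -> differentiable S x.
Proof. by move=> Ux; have [+ _] := sigma_smooth c 1; exact. Qed.

Lemma local_field_diff2 v x : U x -> differentiable (fun y => 'D_v S y) x.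
Proof. by move=> Ux; have [_ /(_ v)[+ _]] := sigma_smooth c 2; exact. Qed.

Lemma local_field_norm x : U x -> mxform (h x) (S x) (S x) = k.
Proof.
move=> /(psi_image M_smooth)[cx _]; rewrite /h mxform_metric_mx//.
by rewrite !coordsK.
Qed.

(** The Christoffel term subtracted in the horizontal lift is the one added to the vertical
    component. *)
Lemma of_coords_lift x y u a : U x ->
  let p := psi c x in let q : TM := (p, of_coords c p y) in
  of_coords (M := TM) c q (row_mx u a) =
  hlift g c q (of_coords c p u) +
  vlift c q (of_coords c p (a + christoffel h x u y)).
Proof.
move=> /(psi_image M_smooth)[cx xE] p q.
rewrite /hlift /vlift /= !of_coordsK// xE -/h.
rewrite /of_coords -linearD; congr ('d _ _ _).
by rewrite add_row_mx addr0 addrC addrK.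
Qed.

(** Splitting both vectors into lifts leaves only the horizontal and vertical products; this
    establishes [H_kk] for the actual metrics. *)
Lemma chart_kaluza_klein x y u v a b : U x ->
  let q := mxform (h x) y y in
  let a' := a + christoffel h x u y in
  let b' := b + christoffel h x v y in
  mxform (H (row_mx x y)) (row_mx u a) (row_mx v b) =
  mxform (h x) u v + B q * mxform (h x) a' b' +
  C q * mxform (h x) a' y * mxform (h x) b' y.
Proof.
move=> Ux q a' b'; have [cx _] := psi_image M_smooth Ux.
rewrite /H mxform_metric_mx// /=.
rewrite row_mxKl row_mxKr !of_coords_lift// -/a' -/b'.
set e := of_coords c (psi c x) y.
set Z := (psi c x, e).
have GD (w1 w2 w : 'rV[R]_(dim TM)) : G Z (w1 + w2) w = G Z w1 w + G Z w2 w.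
  by rewrite -[w1]scale1r G_lin mul1r scale1r.
have GDr (w1 w2 w : 'rV[R]_(dim TM)) : G Z w (w1 + w2) = G Z w w1 + G Z w w2.
  by rewrite G_sym GD ![G Z _ w]G_sym.
rewrite GD !GDr [G _ (vlift _ _ _) (hlift _ _ _ _)]G_sym.
rewrite (kk_hh G_kk) // !(kk_hv G_kk) // (kk_vv G_kk) // mul1r addr0 add0r.
by rewrite /q /h !mxform_metric_mx// addrA.
Qed.

(** The coordinate expression of the section agrees with [graph S] on the open set [U], which
    determines its derivatives there. The base component is the identity, so its second derivative
    is [0]. *)
Lemma second_fundamental_form_section x u v : U x ->
  second_fundamental_form g G c (c : index TM)
    (phi (a := TM) c \o section sigma \o psi c) x u v =
  row_mx 0 ('D_u (fun y => 'D_v S y) x)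
  - row_mx (christoffel h x u v) ('D_(christoffel h x u v) S x)
  + christoffel H (graph S x) (row_mx u ('D_u S x)) (row_mx v ('D_v S x)).
Proof.
move=> Ux; set F := _ \o _.
have FE y : U y -> F y = graph S y.
  by move=> /(psi_image M_smooth)[_ yE]; rewrite /F /= yE.
have near_U y : U y -> \forall z \near y, U z.
  by move=> Uy; apply: open_nbhs_nbhs; split => //; exact: open_chart.
have DF w y : U y -> 'D_w F y = row_mx w ('D_w S y).
  move=> Uy; have [_ <-] := is_derive_graph local_field_diff w Uy.
  by apply: near_eq_derive; apply: filterS (near_U _ Uy) => z; exact: FE.
have DDF : 'D_u (fun y => 'D_v F y) x = row_mx 0 ('D_u (fun y => 'D_v S y) x).
  have d2 := derivableP (@diff_derivable _ _ _ _ x u (local_field_diff2 v Ux)).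
  have [_ <-] := is_derive_row_mx (is_derive_cst v x u) d2.
  by apply: near_eq_derive; apply: filterS (near_U _ Ux) => z; exact: DF.
have congr_terms (a a' b b' z z' d d' e e' : 'rV[R]_(dim M + dim M)) :
    a = a' -> b = b' -> z = z' -> d = d' -> e = e' ->
    a - b + christoffel H z d e = a' - b' + christoffel H z' d' e'.
  by do 5!move=> ->.
exact: (congr_terms _ _ _ _ _ _ _ _ _ _ DDF (DF _ _ Ux) (FE _ Ux)
  (DF u _ Ux) (DF v _ Ux)).
Qed.

Lemma bundle_metric_pos x y a : U x -> chart_at (psi c x) = c -> a != 0 ->
  0 < mxform (H (row_mx x y)) a a.
Proof.
move=> Ux xc a0; rewrite /H mxform_metric_mx// !of_coords_bundle//.
exact: G_pos.
Qed.

Lemma tension_section_vertical x : 0 < k -> U x -> chart_at (psi c x) = c ->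
  mxform (H (graph S x))
    (\sum_i \sum_j invmx (h x) i j *:
      second_fundamental_form g G c (c : index TM)
        (phi (a := TM) c \o section sigma \o psi c) x
        (delta_mx 0 i) (delta_mx 0 j)) (row_mx 0 (S x)) =
  - (B k + k * halfline_derive B k) *
    \sum_i \sum_j invmx (h x) i j *
      mxform (h x) (nabla h S (delta_mx 0 i) x) (nabla h S (delta_mx 0 j) x).
Proof.
move=> k0 Ux xc.
have h_unit y : U y -> h y \in unitmx.
  by move=> Uy; apply: posdef_unitmx => v; exact: chart_metric_pos.
have H_diff i j : differentiable (fun z => H z i j) (graph S x).
  have [+ _] := metric_Ck (kk_riemannian G_kk) (c : index TM) i j; apply.
  have [cx xE] := psi_image M_smooth Ux.
  by exists (section sigma (psi c x)) => //=; rewrite xE.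
have B_derive : is_derive k 1 B (halfline_derive B k).
  apply: halfline_is_derive => //.
  by have [+ _] := kkB_C2 G_kk; apply; exact: ltW.
have C_derive : is_derive k 1 C (halfline_derive C k).
  apply: halfline_is_derive => //.
  by have [+ _] := kkC_C2 G_kk; apply; exact: ltW.
pose E i j := mxform (H (graph S x))
  (row_mx 0 ('D_(delta_mx 0 i) (fun y => 'D_(delta_mx 0 j) S y) x))
  (row_mx 0 (S x)).
pose m i j :=
  mxform (h x) (nabla h S (delta_mx 0 i) x) (nabla h S (delta_mx 0 j) x).
pose P := invmx (h x).
have term i j : mxform (H (graph S x))
    (second_fundamental_form g G c (c : index TM)
        (phi (a := TM) c \o section sigma \o psi c) x
        (delta_mx 0 i) (delta_mx 0 j)) (row_mx 0 (S x)) =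
    2^-1 * (E i j - E j i) - (B k + k * halfline_derive B k) * m i j.
  rewrite second_fundamental_form_section//.
  have H_unit : H (graph S x) \in unitmx.
    by apply: posdef_unitmx => a; exact: bundle_metric_pos.
  exact: (second_fundamental_form_vertical (@open_chart _ _ M_smooth c)
    (fun y _ => metric_mx_sym g_sym c y) h_unit chart_metric_diff
    local_field_diff local_field_norm chart_kaluza_klein Ux
    (fun v => local_field_diff2 v Ux) (metric_mx_sym G_sym _ _) H_unit H_diff
    B_derive C_derive (delta_mx 0 i) (delta_mx 0 j)
    (christoffel h x (delta_mx 0 i) (delta_mx 0 j))).
have P_sym i j : P i j = P j i.
  have hs : (h x)^T = h x by exact: metric_mx_sym.
  by rewrite /P -[in LHS]hs -trmx_inv mxE.
(* The symmetric inverse metric annihilates the antisymmetric second-derivative term. *)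
have antisym : \sum_i \sum_j P i j * (E i j - E j i) = 0.
  rewrite (eq_bigr
    (fun i => \sum_j P i j * E i j - \sum_j P i j * E j i)); last first.
    by move=> i _; rewrite -sumrB; apply: eq_bigr => j _; rewrite mulrBr.
  rewrite sumrB [X in _ - X]exchange_big.
  apply/eqP; rewrite subr_eq0; apply/eqP.
  by apply: eq_bigr => i _; apply: eq_bigr => j _; rewrite P_sym.
transitivity (\sum_i \sum_j (2^-1 * (P i j * (E i j - E j i))
    - (B k + k * halfline_derive B k) * (P i j * m i j))).
  rewrite mxform_suml; apply: eq_bigr => i _.
  rewrite mxform_suml; apply: eq_bigr => j _.
  have alg (p d mij t : R) :
      t = 2^-1 * d - (B k + k * halfline_derive B k) * mij ->
      p * t = 2^-1 * (p * d) - (B k + k * halfline_derive B k) * (p * mij).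
    by move=> ->; ring.
  exact: etrans (mxformZl _ _ _ _) (alg _ _ _ _ (term i j)).
under eq_bigr => i _ do rewrite sumrB -!mulr_sumr.
by rewrite sumrB -!mulr_sumr antisym mulr0 add0r mulNr.
Qed.

(** In the chart the vertical part of a horizontal lift is a Christoffel term minus itself, while
    the Euler vector has no horizontal part. *)
Lemma hlift_vertical x X : U x -> chart_at (psi c x) = c ->
  mxform (H (graph S x))
    (hlift g c (section sigma (psi c x)) X) (row_mx 0 (S x)) = 0.
Proof.
move=> Ux xc; have [cx xE] := psi_image M_smooth Ux.
have qE : section sigma (psi c x) =
    psi (a := tangent_bundle M) c (row_mx x (S x)) :> TM.
  by rewrite /= row_mxKl row_mxKr coordsK.
rewrite /hlift qE of_coords_bundle// /= row_mxKl row_mxKr xE.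
rewrite of_coordsK// -/h /graph chart_kaluza_klein//.
by rewrite addNr christoffel0l mxform0r !mxform0l !mulr0 mul0r !addr0.
Qed.

End Assembly.

(** * From the trace formula to the alternative *)

Lemma nabla_sum (R : realType) (n : nat) (h : 'rV[R]_n -> 'M[R]_n)
    (S : 'rV[R]_n -> 'rV[R]_n) (v x : 'rV[R]_n) : differentiable S x ->
  nabla h S v x = \sum_i v 0 i *: nabla h S (delta_mx 0 i) x.
Proof.
move=> dS; rewrite /nabla (derive_rVE v dS).
under [RHS]eq_bigr do rewrite scalerDr.
rewrite big_split/=; congr (_ + _); apply/rowP => l.
rewrite summxE mxE; apply: eq_bigr => i _; rewrite !mxE [in RHS](bigD1 i)//=.
rewrite [X in _ * (_ + X)]big1 ?addr0; last first.
  move=> j ji; rewrite big1// => m _.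
  by rewrite mxE eqxx (negbTE ji) mulr0 mul0r.
rewrite mulr_sumr; apply: eq_bigr => m _; rewrite mxE !eqxx mulr1 mulrCA.
by rewrite mulrA.
Qed.

Theorem proposition4p1 (R : realType) (M : atlas R) (g : metric M)
    (B C : R -> R) (G : metric (tangent_bundle M)) (sigma : vector_field M)
    (k : R) :
  smooth_manifold M ->
  riemannian g ->
  kaluza_klein g (fun=> 1) B C G ->
  smooth_vector_field sigma ->
  (forall p : M, Num.sqrt (g p (sigma p) (sigma p)) = k) ->
  harmonic_section g G sigma \/ harmonic_map g G (section sigma) ->
  parallel g sigma \/ B (k ^+ 2) + k ^+ 2 * halfline_derive B (k ^+ 2) = 0.
Proof.
move=> M_smooth g_riem G_kk sigma_smooth sigma_sqrt harm.
have g_pos := metric_pos (g_riem 0).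
have g_sym := metric_sym (g_riem 0).
have g_ge0 p v : 0 <= g p v v.
  have [->|/(g_pos p)/ltW//] := eqVneq v 0.
  have := metric_linear (g_riem 0) p (-1) 0 0 0.
  by rewrite scaler0 addr0 mulN1r addNr => ->.
have sigma_norm p : g p (sigma p) (sigma p) = k ^+ 2.
  by rewrite -(sigma_sqrt p) sqr_sqrtr.
(* The value [0] is treated apart: there [B] has only a one-sided derivative, but [sigma] vanishes
   and is therefore parallel. *)
have [k0|k_neq0] := eqVneq k 0.
  left=> p X.
  have sigma0 q : sigma q = 0.
    apply/eqP; apply: contraT => /(g_pos q).
    by rewrite sigma_norm k0 expr0n ltxx.
  rewrite /covariant_derivative.
  have -> : (fun x => coords (chart_at p) (psi (chart_at p) x)
      (sigma (psi (chart_at p) x))) = cst 0.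
    by apply/funext => x; rewrite sigma0 /coords linear0.
  rewrite derive_cst add0r /= sigma0 /coords linear0.
  by rewrite -[X in christoffel _ _ _ X](scale0r 0) christoffelZr scale0r.
have k2_gt0 : 0 < k ^+ 2 by rewrite exprn_even_gt0.
have [|B_neq0] := eqVneq (B (k ^+ 2) + k ^+ 2 * halfline_derive B (k ^+ 2)) 0.
  by right.
left=> p X.
set c := chart_at p; set x := phi c p.
have cp : dom c p by exact: dom_chart_at.
have Ux : (phi c @` dom c)%classic x by exists p.
have px : psi c x = p by rewrite /x (phiK M_smooth).
have xc : chart_at (psi c x) = c by rewrite px.
set h := metric_mx g c; set S := local_field sigma c.
(* For a harmonic map the tension is zero; for a harmonic section it is horizontal, hence orthogonal
   to the Euler vector. *)
have vert0 : mxform (metric_mx G (c : index (tangent_bundle M)) (graph S x))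
    (tension g G (section sigma) p) (row_mx 0 (S x)) = 0.
  case: harm => [[tau_h [tau_v [tauE tau_v0]]]|->]; last by rewrite mxform0l.
  rewrite tauE tau_v0.
  have -> : vlift (chart_at p) (section sigma p) 0 = 0.
    by rewrite /vlift /coords linear0 row_mx0 /of_coords linear0.
  rewrite addr0 -/c -[p in section sigma p]px.
  exact: (hlift_vertical sigma M_smooth g_riem G_kk (tau_h p) Ux xc).
have := tension_section_vertical M_smooth g_riem G_kk sigma_smooth sigma_norm
  k2_gt0 Ux xc.
(* The nonzero coefficient is cancelled, so the trace, which is the squared norm of the covariant
   derivative, is zero. *)
rewrite vert0 => /esym/eqP; rewrite mulf_eq0 oppr_eq0 (negbTE B_neq0) /=.
move=> /eqP/trace_mxform_eq0 nabla0.
have -> : covariant_derivative g sigma p X = nabla h S X x by [].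
rewrite nabla_sum; last exact: (local_field_diff sigma_smooth Ux).
apply: big1 => i _; rewrite nabla0 ?scaler0//.
- by move=> v; exact: (chart_metric_pos M_smooth g_riem Ux).
- exact: metric_mx_sym.
Qed.
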